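(* Let $\mathcal{L}$ be a polar space. Then for all $p,q\in\mathcal{L}$ the fractional join of $p$ and $q$ equals $\frac12(p\vee_L q)+\frac12(p\vee_R q)$ (as formal combinations, coefficients of equal elements being added); i.e., the fractional join operation of $\mathcal{L}$ is $\frac12\vee_L+\frac12\vee_R$.
   Context: $\mathcal{S}_2=\{-1,0,1\}$ is the poset with minimum $0$ and incomparable $-1,1$; $\mathcal{S}_2^n$ has the componentwise order. A polar space of rank $n$ is a meet-semilattice $\mathcal{L}$ that is a union of subsemilattices called polar frames such that (P0) each polar frame is isomorphic to $\mathcal{S}_2^n$; (P1) any two chains of $\mathcal{L}$ lie in a common polar frame; (P2) if polar frames $\mathcal{F},\mathcal{F}'$ both contain chains $C,D$, there is an isomorphism $\mathcal{F}\to\mathcal{F}'$ fixing $C$ and $D$ pointwise. A polar space is a modular semilattice (a meet-semilattice of finite rank, rank function $r$, whose principal ideals are modular lattices and in which $x\vee y\vee z$ exists whenever $x\vee y,y\vee z,z\vee x$ exist). Left/right join: for $p,q$, there is a unique maximal $u\in[p\wedge q,q]$ such that $p\vee u$ exists; $p\vee_L q:=p\vee u$. Similarly $p\vee_R q:=q\vee v$ for the unique maximal $v\in[p\wedge q,p]$ with $q\vee v$ existing. Fractional join: for $p,q$ let $I(p,q)$ be the set of elements on shortest $p$–$q$ paths of the covering graph of $\mathcal{L}$; $r(u;p,q)=(r(u\wedge p)-r(p\wedge q),r(u\wedge q)-r(p\wedge q))$; $\mathrm{Conv}I(p,q)$ the convex hull of these vectors; $\mathcal{E}(p,q)$ the set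 of $u\in I(p,q)$ with $r(u;p,q)$ a componentwise-maximal extreme point of $\mathrm{Conv}I(p,q)$; $C(u;p,q)=\{w\in\mathbf{R}^2_{\ge0}:\langle w,r(u;p,q)\rangle=\max_{z\in\mathrm{Conv}I(p,q)}\langle w,z\rangle\}$, which has the form $\{(x,y)\in\mathbf{R}^2_{\ge 0}:y\cos\alpha\le x\sin\alpha,\ y\cos\beta\ge x\sin\beta\}$ with $0\le\beta\le\alpha\le\pi/2$, and $[C(u;p,q)]=\frac{\sin\alpha}{\sin\alpha+\cos\alpha}-\frac{\sin\beta}{\sin\beta+\cos\beta}$. The fractional join of $p,q$ is the formal combination $\sum_{u\in\mathcal{E}(p,q)}[C(u;p,q)]\,u$. *)

(* Defs.v *)
From mathcomp Require Import all_boot all_order.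
From Stdlib Require Import Reals ClassicalEpsilon.

Set Implicit Arguments.
Unset Strict Implicit.
Unset Printing Implicit Defensive.

Import Order.Theory.

Inductive S2 : Type := S2m | S20 | S2p.   (* -1, 0, 1 *)

Definition S2le (a b : S2) : Prop := a = S20 \/ a = b.

Definition S2n_le (n : nat) (x y : 'I_n -> S2) : Prop :=
  forall i, S2le (x i) (y i).

Section PolarSpace.
Context {disp : Order.disp_t} {T : meetSemilatticeType disp}.

Definition is_frame (n : nat) (F : T -> Prop) : Prop :=
  (forall x y, F x -> F y -> F (x `&` y)%O) /\
  exists f : ('I_n -> S2) -> T,
    (forall x y, (f x <= f y)%O <-> S2n_le x y) /\
    (forall z, F z <-> exists x, f x = z).

Definition is_chain (C : T -> Prop) : Prop :=
  forall x y, C x -> C y -> (x <= y)%O \/ (y <= x)%O.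

Definition subset_of (A B : T -> Prop) : Prop := forall x, A x -> B x.

(* an isomorphism F -> F' (of posets, hence of the subsemilattices)
   fixing C and D pointwise *)
Definition frame_iso_fixing (F F' C D : T -> Prop) : Prop :=
  exists phi : T -> T,
    (forall x, F x -> F' (phi x)) /\
    (forall y, F' y -> exists x, F x /\ phi x = y) /\
    (forall x y, F x -> F y -> ((phi x <= phi y)%O <-> (x <= y)%O)) /\
    (forall x, C x -> phi x = x) /\
    (forall x, D x -> phi x = x).

Definition is_polar_space (n : nat) (Frames : (T -> Prop) -> Prop) : Prop :=
  (* (P0) *) (forall F, Frames F -> is_frame n F) /\
  (forall x, exists F, Frames F /\ F x) /\
  (* (P1) *) (forall C D, is_chain C -> is_chain D ->
                exists F, Frames F /\ subset_of C F /\ subset_of D F) /\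
  (* (P2) *) (forall F F' C D, Frames F -> Frames F' -> is_chain C -> is_chain D ->
                subset_of C F -> subset_of D F -> subset_of C F' -> subset_of D F' ->
                frame_iso_fixing F F' C D).

Definition is_join (x y z : T) : Prop :=
  (x <= z)%O /\ (y <= z)%O /\ forall w, (x <= w)%O -> (y <= w)%O -> (z <= w)%O.

Definition join_exists (x y : T) : Prop := exists z, is_join x y z.

(* p \vee_L q = p \vee u, u the unique maximal (= greatest, in finite rank)
   element of [p /\ q, q] such that p \vee u exists *)
Definition ljoin (p q : T) : T :=
  epsilon (inhabits p) (fun z => exists u,
    ((p `&` q) <= u)%O /\ (u <= q)%O /\ join_exists p u /\
    (forall v, ((p `&` q) <= v)%O -> (v <= q)%O -> join_exists p v -> (v <= u)%O) /\
    is_join p u z).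

Definition rjoin (p q : T) : T :=
  epsilon (inhabits p) (fun z => exists v,
    ((p `&` q) <= v)%O /\ (v <= p)%O /\ join_exists q v /\
    (forall w, ((p `&` q) <= w)%O -> (w <= p)%O -> join_exists q w -> (w <= v)%O) /\
    is_join q v z).

Definition chain_to (x : T) (k : nat) : Prop :=
  exists c : nat -> T, c k = x /\ forall i, (i < k)%nat -> (c i < c i.+1)%O.

Definition rank (x : T) : nat :=
  epsilon (inhabits 0%nat)
    (fun k => chain_to x k /\ forall m, chain_to x m -> (m <= k)%nat).

Definition covers (x y : T) : Prop :=
  (x < y)%O /\ forall z, ~ ((x < z)%O /\ (z < y)%O).

Definition adjacent (x y : T) : Prop := covers x y \/ covers y x.

Definition walk (w : nat -> T) (k : nat) (p q : T) : Prop :=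
  w 0%nat = p /\ w k = q /\ forall i, (i < k)%nat -> adjacent (w i) (w i.+1).

Definition shortest_walk (w : nat -> T) (k : nat) (p q : T) : Prop :=
  walk w k p q /\ forall w' k', walk w' k' p q -> (k <= k')%nat.

Definition Iset (p q : T) (u : T) : Prop :=
  exists w k, shortest_walk w k p q /\ exists i, (i <= k)%nat /\ w i = u.

Local Open Scope R_scope.

Definition rvec (p q u : T) : R * R :=
  (INR (rank (u `&` p)%O) - INR (rank (p `&` q)%O),
   INR (rank (u `&` q)%O) - INR (rank (p `&` q)%O)).

Fixpoint fsum (f : nat -> R) (k : nat) : R :=
  match k with O => 0 | S k' => fsum f k' + f k' end.

Definition ConvI (p q : T) (z : R * R) : Prop :=
  exists (k : nat) (lam : nat -> R) (us : nat -> T),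
    (forall i, (i < k)%nat -> 0 <= lam i /\ Iset p q (us i)) /\
    fsum lam k = 1 /\
    fst z = fsum (fun i => lam i * fst (rvec p q (us i))) k /\
    snd z = fsum (fun i => lam i * snd (rvec p q (us i))) k.

Definition extreme_point (K : R * R -> Prop) (z : R * R) : Prop :=
  K z /\ ~ exists a b t, K a /\ K b /\ a <> b /\ 0 < t < 1 /\
                        z = (t * fst a + (1 - t) * fst b, t * snd a + (1 - t) * snd b).

Definition cw_maximal (K : R * R -> Prop) (z : R * R) : Prop :=
  K z /\ forall z', K z' -> fst z <= fst z' -> snd z <= snd z' -> z' = z.

Definition Eset (p q : T) (u : T) : Prop :=
  Iset p q u /\ extreme_point (ConvI p q) (rvec p q u) /\ cw_maximal (ConvI p q) (rvec p q u).

Definition dot (w z : R * R) : R := fst w * fst z + snd w * snd z.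

Definition Ccone (p q u : T) (w : R * R) : Prop :=
  0 <= fst w /\ 0 <= snd w /\
  forall z, ConvI p q z -> dot w z <= dot w (rvec p q u).

Definition cone_value (C : R * R -> Prop) (c : R) : Prop :=
  exists a b, 0 <= b /\ b <= a /\ a <= PI / 2 /\
    (forall x y, C (x, y) <->
       (0 <= x /\ 0 <= y /\ y * cos a <= x * sin a /\ y * cos b >= x * sin b)) /\
    c = sin a / (sin a + cos a) - sin b / (sin b + cos b).

(* coefficient of u in the fractional join sum_{u in E(p,q)} [C(u;p,q)] u *)
Definition fjoin_coef (p q u : T) : R :=
  epsilon (inhabits 0)
    (fun c => (Eset p q u -> cone_value (Ccone p q u) c) /\ (~ Eset p q u -> c = 0)).

End PolarSpace.

(* Main.v *)
Require Import Defs.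
From mathcomp Require Import all_boot all_order.
From mathcomp Require Import zify.
From Stdlib Require Import Reals Lra ClassicalEpsilon FunctionalExtensionality.

(* Two elements p, q lie in a common polar frame, hence become sign vectors x, y;
   transporting frames by (P2) shows that joins, ranks and left joins may be
   computed in any frame: p \vee_L q is the vector equal to x where x is nonzero
   and to y elsewhere.  Since the graph distance is r(p) + r(q) - 2 r(p /\ q),
   u lies in I(p,q) iff r(u/\p) + r(u/\q) = r(u) + r(p/\q).  With
   P = r(p) - r(p/\q), Q = r(q) - r(p/\q) and M = r(p \vee_L q) - r(p/\q), all
   points of Conv I(p,q) satisfy s <= P, t <= Q, s + t <= M, and the left and right
   joins are the only elements sitting at the corners (P, M - P) and (M - Q, Q).
   If these differ, the edge joining them has slope -1, so the quadrant is cut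
   into two cones along its diagonal, each of value 1/2; otherwise the single
   cone is the whole quadrant, of value 1. *)

Set Implicit Arguments.
Unset Strict Implicit.
Unset Printing Implicit Defensive.

Import Order.Theory.

(** * Order, partial joins and sizes in the poset of sign vectors *)

Section SignVectors.
Context {n : nat}.
Implicit Types x y z w : 'I_n -> S2.

Definition nz (a : S2) : bool := if a is S20 then false else true.

(** The rank of [x] in the poset of sign vectors; [frame_rank] identifies it with the rank in the
    whole space. *)
Definition vsize x : nat := \sum_(i < n) nz (x i).

Definition vmeet x y : 'I_n -> S2 := fun i =>
  match x i, y i with
  | S2m, S2m => S2m
  | S2p, S2p => S2p
  | _, _ => S20
  end.

(** A total operation: the join of [x] and [y] when they have an upper bound, and in general the
    sign vector of the left join. *)
Definition vover x y : 'I_n -> S2 := fun i => if nz (x i) then x i else y i.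

Lemma vle_refl x : S2n_le x x.
Proof. by move=> i; right. Qed.

Lemma vle_trans x y z : S2n_le x y -> S2n_le y z -> S2n_le x z.
Proof. by move=> xy yz i; case: (xy i) => [->|->]; [left | apply: yz]. Qed.

Lemma vle_anti x y : S2n_le x y -> S2n_le y x -> x = y.
Proof.
move=> xy yx; apply: functional_extensionality => i.
by case: (xy i) => // x0; case: (yx i) => // y0; rewrite x0 y0.
Qed.

Lemma vmeet_le x y : S2n_le (vmeet x y) x /\ S2n_le (vmeet x y) y.
Proof.
by split=> i; rewrite /vmeet /S2le; case: (x i); case: (y i); auto.
Qed.

Lemma le_vmeet x y z : S2n_le z x -> S2n_le z y -> S2n_le z (vmeet x y).
Proof.
move=> zx zy i; have := zx i; have := zy i.
by rewrite /vmeet /S2le; case: (x i); case: (y i); intuition congruence.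
Qed.

Lemma le_vover x y : S2n_le x (vover x y).
Proof. by move=> i; rewrite /vover /S2le; case: (x i); auto. Qed.

Lemma vover_le x y z : S2n_le x z -> S2n_le y z -> S2n_le (vover x y) z.
Proof. by move=> xz yz i; rewrite /vover; case: ifP. Qed.

Lemma le_vover_r x y z : S2n_le x z -> S2n_le y z -> S2n_le y (vover x y).
Proof.
move=> xz yz i; have := xz i; have := yz i.
by rewrite /vover /S2le; case: (x i); case: (y i) => /=; intuition congruence.
Qed.

(** The vector [vmeet (vover x y) y] is [y] with the entries opposite to those of [x] set to 0. It
    plays the role of the element u in the definition of the left join; having an upper bound in
    common with [x] is the first thing to check. *)
Lemma vover_compat x y : S2n_le (vmeet (vover x y) y) (vover x (vmeet (vover x y) y)).
Proof.
by move=> i; rewrite /vover /vmeet /S2le; case: (x i); case: (y i); auto.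
Qed.

Lemma vover_vmeet x y : vover x (vmeet (vover x y) y) = vover x y.
Proof.
apply: functional_extensionality => i.
by rewrite /vover /vmeet; case: (x i); case: (y i).
Qed.

(** Maximality of the compatible part: where [x] and [y] have opposite signs, [w] agrees with [x],
    so an entry of [v] below both [y] and [w] must be 0. *)
Lemma le_compat_part x y v w : S2n_le v y -> S2n_le x w -> S2n_le v w ->
  S2n_le v (vmeet (vover x y) y).
Proof.
move=> vy xw vw i; have := vy i; have := xw i; have := vw i.
by rewrite /vover /vmeet /S2le; case: (x i); case: (y i) => /=; intuition congruence.
Qed.

Lemma vsize_le x y : S2n_le x y -> vsize x <= vsize y.
Proof. by move=> xy; apply: leq_sum => i _; case: (xy i) => ->. Qed.

Lemma vsize_inj x y : S2n_le x y -> vsize y <= vsize x -> x = y.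
Proof.
move=> xy yx.
(* The sums compare term by term, so equality of the sums forces equality of the terms. *)
have leif i : true -> nz (x i) <= nz (y i) ?= iff (nz (x i) == nz (y i)).
  by move=> _; case: (xy i) => ->; split=> //=; case: (y i).
have [le eqs] := leqif_sum leif.
have : vsize x == vsize y by rewrite eqn_leq yx [X in X && _]le.
rewrite [_ == _]eqs => /forallP E.
apply: functional_extensionality => i.
by move: (E i); case: (xy i) => -> //=; case: (y i).
Qed.

Lemma vsize_modular x y : S2n_le y (vover x y) ->
  vsize (vover x y) + vsize (vmeet x y) = vsize x + vsize y.
Proof.
move=> yx; rewrite /vsize -!big_split /=; apply: eq_bigr => i _.
have := yx i; rewrite /vover /vmeet /S2le.
by case: (x i); case: (y i) => //=; intuition congruence.
Qed.

(** A coordinatewise count: at a conflict of signs the compatible part and the meet both vanish,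
    while [x] and [vover x y] contribute 1 each. *)
Lemma vsize_vover_part x y :
  vsize (vmeet (vover x y) y) + vsize x = vsize (vover x y) + vsize (vmeet x y).
Proof.
rewrite /vsize -!big_split /=; apply: eq_bigr => i _.
by rewrite /vover /vmeet; case: (x i); case: (y i).
Qed.

Lemma vsize_voverC x y : vsize (vover x y) = vsize (vover y x).
Proof.
rewrite /vsize; apply: eq_bigr => i _.
by rewrite /vover; case: (x i); case: (y i).
Qed.

(** At a conflict of signs between [x] and [y], the common bound [w] lets only one of [s], [t] be
    nonzero; both can be nonzero only where [x] and [y] agree. This is the source of the bound s + t
    <= M. *)
Lemma vsize_compat x y s t w : S2n_le s x -> S2n_le t y -> S2n_le s w ->
  S2n_le t w -> vsize s + vsize t <= vsize (vover x y) + vsize (vmeet x y).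
Proof.
move=> sx ty sw tw; rewrite /vsize -!big_split /=; apply: leq_sum => i _.
have := sx i; have := ty i; have := sw i; have := tw i.
rewrite /vover /vmeet /S2le.
by case: (s i); case: (t i); case: (x i); case: (y i) => //=; intuition congruence.
Qed.

Lemma vle_step x y : S2n_le x y -> vsize x < vsize y ->
  exists z, [/\ S2n_le x z, S2n_le z y & vsize z = (vsize x).+1].
Proof.
move=> xy lt.
have [i /andP[/negbTE xi yi]] : exists i, ~~ nz (x i) && nz (y i).
  apply/existsP; apply: contraT => /existsPn E.
  suff : vsize y <= vsize x by rewrite leqNgt lt.
  by apply: leq_sum => i _; move: (E i); case: (nz (x i)); case: (nz (y i)).
have xi0 : x i = S20 by move: xi; case: (x i).
exists (fun j => if j == i then y j else x j); split.
- by move=> j; case: eqP => [->|_]; [left | right].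
- by move=> j; case: eqP => [_|_]; [right | apply: xy].
- rewrite /vsize (bigD1 i) //= [in RHS](bigD1 i) //= eqxx yi xi add0n add1n.
  by congr S; apply: eq_bigr => j /negbTE ->.
Qed.

Lemma vle_chain k x y : S2n_le x y -> vsize y = vsize x + k ->
  exists c : nat -> 'I_n -> S2, [/\ c 0 = x, c k = y & forall i, i < k ->
    S2n_le (c i) (c i.+1) /\ vsize (c i.+1) = (vsize (c i)).+1].
Proof.
elim: k x => [|k IH] x xy sz.
  by exists (fun=> x); split=> //; apply: vsize_inj => //; rewrite sz addn0.
have [|z [xz zy szz]] := vle_step xy; first by rewrite sz; lia.
have [|c [c0 ck cs]] := IH _ zy; first by rewrite sz szz; lia.
exists (fun i => if i is j.+1 then c j else x); split=> // -[|i] //= lt.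
  by rewrite c0.
exact: cs.
Qed.

End SignVectors.

(** * Polar frames as coordinate systems, and transport between them *)

Section Frames.
Context {disp : Order.disp_t} {T : meetSemilatticeType disp}.
Context {n : nat} {Frames : (T -> Prop) -> Prop}.
Hypothesis polar : is_polar_space n Frames.
Implicit Types (f g : ('I_n -> S2) -> T) (p q u : T).

Definition frame_map f : Prop :=
  exists F, [/\ Frames F, forall z, F z <-> exists x, f x = z,
    forall x y, (f x <= f y)%O <-> S2n_le x y &
    forall x y, F x -> F y -> F (x `&` y)%O].

(** (P1) for a chain of three elements and a chain of two, the largest configuration of this kind
    used below. *)
Lemma frame_map_exists a b c d e : (a <= b)%O -> (b <= c)%O -> (d <= e)%O ->
  exists f, frame_map f /\ exists xa xb xc xd xe,
    [/\ f xa = a, f xb = b, f xc = c, f xd = d & f xe = e].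
Proof.
move=> ab bc de; have [P0 [_ [P1 _]]] := polar.
have ac := le_trans ab bc.
have [||F [FF [sC sD]]] :=
  P1 (fun z => [\/ z = a, z = b | z = c]) (fun z => z = d \/ z = e).
- by move=> x y [->|->|->] [->|->|->]; rewrite ?lexx ?ab ?bc ?ac; auto.
- by move=> x y [->|->] [->|->]; rewrite ?lexx ?de; auto.
have [mF [f [fle Ff]]] := P0 _ FF.
have [xa fa] : exists x, f x = a by apply/Ff; apply: sC; constructor 1.
have [xb fb] : exists x, f x = b by apply/Ff; apply: sC; constructor 2.
have [xc fc] : exists x, f x = c by apply/Ff; apply: sC; constructor 3.
have [xd fd] : exists x, f x = d by apply/Ff; apply: sD; left.
have [xe fe] : exists x, f x = e by apply/Ff; apply: sD; right.
exists f; split; first by exists F.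
by exists xa, xb, xc, xd, xe.
Qed.

Lemma frame_le f x y : frame_map f -> (f x <= f y)%O <-> S2n_le x y.
Proof. by case=> F [_ _ fle _]. Qed.

Lemma frame_inj f : frame_map f -> injective f.
Proof.
by move=> ff x y E; apply: vle_anti; apply/(frame_le _ _ ff); rewrite E.
Qed.

Lemma frame_meet f x y : frame_map f -> (f x `&` f y)%O = f (vmeet x y).
Proof.
case=> F [_ Ff fle mF].
have [z Ez] : exists z, f z = (f x `&` f y)%O.
  by apply/Ff; apply: mF; apply/Ff; eexists.
apply/le_anti; rewrite lexI; apply/andP; split.
  by rewrite -Ez; apply/fle; apply: le_vmeet; apply/fle; rewrite Ez ?leIl ?leIr.
by have [? ?] := vmeet_le x y; apply/andP; split; apply/fle.
Qed.

(** (P2) in coordinates: [h] is the inverse of [f] after the isomorphism after [g], and it matches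
    the coordinates of the four fixed elements. *)
Lemma frame_transport f g a b c d a' b' c' d' :
  frame_map f -> frame_map g ->
  f a = g a' -> f b = g b' -> f c = g c' -> f d = g d' ->
  (f a <= f b)%O -> (f c <= f d)%O ->
  exists h : ('I_n -> S2) -> 'I_n -> S2,
    (forall x y, S2n_le (h x) (h y) <-> S2n_le x y) /\
    [/\ h a' = a, h b' = b, h c' = c & h d' = d].
Proof.
move=> ff gg Ea Eb Ec Ed ab cd.
have [F [FF Ff fle _]] := ff; have [G [GG Gg gle _]] := gg.
have [_ [_ [_ P2]]] := polar.
have [||||||phi [phiF [_ [phile [phiC phiD]]]]] :=
  P2 G F (fun z => z = f a \/ z = f b) (fun z => z = f c \/ z = f d) GG FF.
- by move=> x y [->|->] [->|->]; rewrite ?lexx ?ab; auto.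
- by move=> x y [->|->] [->|->]; rewrite ?lexx ?cd; auto.
- by move=> z [->|->]; apply/Gg; eexists; [rewrite Ea | rewrite Eb].
- by move=> z [->|->]; apply/Gg; eexists; [rewrite Ec | rewrite Ed].
- by move=> z [->|->]; apply/Ff; eexists.
- by move=> z [->|->]; apply/Ff; eexists.
have img x : exists y, f y = phi (g x).
  by apply/Ff; apply: phiF; apply/Gg; eexists.
have [h hE] : exists h, forall x, f (h x) = phi (g x).
  by exists (fun x => proj1_sig (constructive_indefinite_description _ (img x)))
    => x; case: constructive_indefinite_description.
exists h; split.
  move=> x y; rewrite -fle !hE -gle.
  by apply: phile; apply/Gg; eexists.
split; apply: (frame_inj ff); rewrite hE.
- by rewrite -Ea; apply: phiC; left.
- by rewrite -Eb; apply: phiC; right.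
- by rewrite -Ec; apply: phiD; left.
- by rewrite -Ed; apply: phiD; right.
Qed.

(** The bound [w] may lie outside the frame; a second frame holding [w] is transported back with
    [f x] and [f y] fixed, and the image of [w] is a bound inside. *)
Lemma frame_bound f x y w : frame_map f -> (f x <= w)%O -> (f y <= w)%O ->
  exists z, S2n_le x z /\ S2n_le y z.
Proof.
move=> ff xw yw.
have [g [gg [x' [w' [_ [y' [_ [Ex Ew _ Ey _]]]]]]]] :=
  frame_map_exists xw (lexx w) (lexx (f y)).
have [h [hle [hx _ hy _]]] := frame_transport ff gg (esym Ex) (esym Ex)
  (esym Ey) (esym Ey) (lexx _) (lexx _).
exists (h w'); rewrite -hx -hy !hle -!(frame_le _ _ gg) Ex Ey Ew.
by split.
Qed.

Lemma frame_join f x y z : frame_map f -> S2n_le x z -> S2n_le y z ->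
  is_join (f x) (f y) (f (vover x y)).
Proof.
move=> ff xz yz; have xv := le_vover x y; have yv := le_vover_r xz yz.
split; [exact/(frame_le _ _ ff) | split; [exact/(frame_le _ _ ff) |]].
(* An arbitrary upper bound [w] is replaced by its meet with [v], which fits into a chain between
   [f x] and [v]. Transport fixing [f x], [v] and [f y] then shows that this meet is already [v]. *)
move=> w xw yw; set v := f (vover x y).
have xvw : (f x <= v `&` w)%O by rewrite lexI xw andbT; apply/(frame_le _ _ ff).
have yvw : (f y <= v `&` w)%O by rewrite lexI yw andbT; apply/(frame_le _ _ ff).
have [g [gg [x' [t [v' [y' [_ [Ex Et Ev Ey _]]]]]]]] :=
  frame_map_exists xvw (leIl v w) (lexx (f y)).
have [||h [hle [hx hv hy _]]] := frame_transport ff gg (esym Ex) (esym Ev)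
  (esym Ey) (esym Ey); rewrite ?lexx //; first exact/(frame_le _ _ ff).
have : (v <= v `&` w)%O.
  rewrite -Et -Ev; apply/(frame_le _ _ gg)/hle; rewrite hv.
  by apply: vover_le; rewrite -?hx -?hy hle -(frame_le _ _ gg) ?Ex ?Ey Et.
by rewrite lexI => /andP[].
Qed.

Lemma is_join_unique p q u v : is_join p q u -> is_join p q v -> u = v.
Proof.
move=> [pu [qu mu]] [pv [qv mv]]; apply/le_anti.
by apply/andP; split; [apply: mu | apply: mv].
Qed.

(** * Left and right joins in coordinates *)

Definition left_part p q u : Prop :=
  [/\ (p `&` q <= u)%O, (u <= q)%O, join_exists p u &
    forall v, (p `&` q <= v)%O -> (v <= q)%O -> join_exists p v -> (v <= u)%O].

Lemma left_part_unique p q u v : left_part p q u -> left_part p q v -> u = v.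
Proof.
move=> [a1 a2 a3 a4] [b1 b2 b3 b4]; apply/le_anti.
by apply/andP; split; [apply: b4 | apply: a4].
Qed.

Lemma frame_left_join f x y : frame_map f ->
  is_join (f x) (f (vmeet (vover x y) y)) (f (vover x y)).
Proof.
move=> ff; rewrite -{2}vover_vmeet.
by apply: (frame_join ff (le_vover _ _)); apply: vover_compat.
Qed.

Lemma frame_left_part f x y : frame_map f ->
  left_part (f x) (f y) (f (vmeet (vover x y) y)).
Proof.
move=> ff; have [_ uy] := vmeet_le (vover x y) y.
split.
- rewrite (frame_meet _ _ ff); apply/(frame_le _ _ ff).
  have [mx my] := vmeet_le x y; apply: le_vmeet => //.
  exact: vle_trans mx (le_vover _ _).
- exact/(frame_le _ _ ff).
- by eexists; apply: frame_left_join.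
(* [u] is the meet of [f (vover x y)] and [q], so a frame through
   [p <= f (vover x y)] and [v <= q] also contains [u]. *)
move=> v mv vq [z [pz [vz _]]].
have pl : (f x <= f (vover x y))%O by apply/(frame_le _ _ ff)/le_vover.
have [g [gg [x' [l' [_ [v' [y' [Ex El _ Ev Ey]]]]]]]] :=
  frame_map_exists pl (lexx _) vq.
have Eu : f (vmeet (vover x y) y) = g (vmeet l' y').
  by rewrite -(frame_meet _ _ ff) -(frame_meet _ _ gg) El Ey.
have [||h [hle [hx _ hu hy]]] := frame_transport ff gg (esym Ex) (esym Ex)
  Eu (esym Ey); rewrite ?lexx //; first exact/(frame_le _ _ ff).
have [w [xw vw]] : exists w, S2n_le x' w /\ S2n_le v' w.
  by apply: (@frame_bound g _ _ z); rewrite ?Ex ?Ev.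
rewrite Eu -Ev; apply/(frame_le _ _ gg).
have v'y' : S2n_le v' y' by apply/(frame_le _ _ gg); rewrite Ev Ey.
(* Maximality is used twice: in the coordinates of [g] for [v'], then in those of [f] for the
   transported compatible part, whose common bound with [x] is the image under [h] of the
   corresponding bound in [g]. *)
apply: vle_trans (le_compat_part v'y' xw vw) _; apply/hle; rewrite hu.
apply: (@le_compat_part _ _ _ _ (h (vover x' (vmeet (vover x' y') y')))).
- by rewrite -hy hle; case: (vmeet_le (vover x' y') y').
- by rewrite -hx hle; apply: le_vover.
- by rewrite hle; apply: vover_compat.
Qed.

Lemma frame_ljoin f x y : frame_map f -> ljoin (f x) (f y) = f (vover x y).
Proof.
move=> ff; rewrite /ljoin.
have [a1 a2 a3 a4] := frame_left_part x y ff.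
set P := (X in epsilon _ X).
have : P (epsilon (inhabits (f x)) P).
  apply: epsilon_spec; exists (f (vover x y)), (f (vmeet (vover x y) y)).
  by do 4 split=> //; apply: frame_left_join.
case=> u [b1 [b2 [b3 [b4 b5]]]].
have E : u = f (vmeet (vover x y) y) by
  apply: (@left_part_unique _ _ _ _ (And4 b1 b2 b3 b4)); split.
move: b5; rewrite E => b5; apply: is_join_unique b5 (frame_left_join x y ff).
Qed.

Lemma frame_rjoin f x y : frame_map f -> rjoin (f x) (f y) = f (vover y x).
Proof.
move=> ff; rewrite /rjoin meetC.
have [a1 a2 a3 a4] := frame_left_part y x ff.
set P := (X in epsilon _ X).
have : P (epsilon (inhabits (f x)) P).
  apply: epsilon_spec; exists (f (vover y x)), (f (vmeet (vover y x) x)).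
  by do 4 split=> //; apply: frame_left_join.
case=> u [b1 [b2 [b3 [b4 b5]]]].
have E : u = f (vmeet (vover y x) x) by
  apply: (@left_part_unique _ _ _ _ (And4 b1 b2 b3 b4)); split.
move: b5; rewrite E => b5; apply: is_join_unique b5 (frame_left_join y x ff).
Qed.

(** * The rank function: computation in a frame and modularity *)

Lemma frame_lt f x y : frame_map f -> (f x < f y)%O -> vsize x < vsize y.
Proof.
move=> ff /[dup] xy /ltW /(frame_le _ _ ff) le.
rewrite ltnNge; apply/negP => /(vsize_inj le) E.
by move: xy; rewrite E ltxx.
Qed.

(** By (P1) the whole chain lies in one frame together with [f x]. Sizes are counted after transport
    to [f], where every strict step of the chain raises the size by at least 1. *)
Lemma chain_bound f x m : frame_map f -> chain_to (f x) m -> m <= vsize x.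
Proof.
move=> ff [c [cm cs]].
have cle i j : i <= j -> j <= m -> (c i <= c j)%O.
  elim: j => [|j IH]; first by rewrite leqn0 => /eqP->.
  rewrite leq_eqVlt => /predU1P[->//|]; rewrite ltnS => ij jm.
  by apply: (le_trans (IH ij (ltnW jm))); apply/ltW/cs.
have [P0 [_ [P1 _]]] := polar.
have [||G [GG [sC sD]]] :=
  P1 (fun z => exists2 i, i <= m & z = c i) (fun z => z = f x).
- move=> a b [i im ->] [j jm ->].
  by case: (leqP i j) => [ij|/ltnW ji]; [left | right]; apply: cle.
- by move=> a b -> ->; left.
have [mG [g [gle Gg]]] := P0 _ GG.
have gg : frame_map g by exists G.
have [x' Ex] : exists x', g x' = f x by apply/Gg/sD.
have [h [hle [hx _ _ _]]] := frame_transport ff gg (esym Ex) (esym Ex)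
  (esym Ex) (esym Ex) (lexx _) (lexx _).
have sz i s : i <= m -> g s = c i -> i <= vsize (h s).
  elim: i s => // i IH s im Es.
  have [t Et] : exists t, g t = c i by apply/Gg/sC; exists i => //; apply: ltnW.
  apply: leq_ltn_trans (IH t (ltnW im) Et) _.
  have ts : (g t < g s)%O by rewrite Et Es; apply: cs.
  have le : S2n_le (h t) (h s) by apply/hle/(frame_le _ _ gg)/ltW.
  rewrite ltnNge; apply/negP => /(vsize_inj le) E.
  move: ts; suff -> : t = s by rewrite ltxx.
  by apply: vle_anti; apply/hle; rewrite E; apply: vle_refl.
by rewrite -hx; apply: sz; rewrite ?cm.
Qed.

Lemma frame_rank f x : frame_map f -> rank (f x) = vsize x.
Proof.
move=> ff.
have ch : chain_to (f x) (vsize x).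
  have [||c [_ cx cs]] := @vle_chain n (vsize x) (fun=> S20) x.
  - by move=> i; left.
  - by rewrite /vsize [X in X + _]big1.
  exists (f \o c); split; first by rewrite /= cx.
  move=> i /cs [le sz]; rewrite lt_neqAle; apply/andP; split.
    by apply/eqP => /(frame_inj ff) E; move: sz; rewrite E; lia.
  exact/(frame_le _ _ ff).
rewrite /rank; set P := (X in epsilon _ X).
have [r1 r2] : P (epsilon (inhabits 0) P).
  by apply: epsilon_spec; exists (vsize x); split=> // m; apply: chain_bound.
by apply/eqP; rewrite eqn_leq r2 // (chain_bound ff).
Qed.

Lemma frame2 p q : exists f, frame_map f /\ exists x y, f x = p /\ f y = q.
Proof.
have [f [ff [x [_ [_ [y [_ [Ex _ _ Ey _]]]]]]]] :=
  frame_map_exists (lexx p) (lexx p) (lexx q).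
by exists f; split=> //; exists x, y.
Qed.

Lemma rank_le p q : (p <= q)%O -> rank p <= rank q.
Proof.
have [f [ff [x [y [<- <-]]]]] := frame2 p q.
by rewrite !(frame_rank _ ff) => /(frame_le _ _ ff) /vsize_le.
Qed.

Lemma rank_inj p q : (p <= q)%O -> rank q <= rank p -> p = q.
Proof.
have [f [ff [x [y [<- <-]]]]] := frame2 p q.
by rewrite !(frame_rank _ ff) => /(frame_le _ _ ff) le /(vsize_inj le) ->.
Qed.

Lemma rank_lt p q : (p < q)%O -> rank p < rank q.
Proof.
move=> pq; rewrite ltnNge; apply/negP => /(rank_inj (ltW pq)) E.
by move: pq; rewrite E ltxx.
Qed.

(** The vector of [u] dominates that of the join of [p] and [q], for which the modular law is
    exact. *)
Lemma rank_submodular p q u : (p <= u)%O -> (q <= u)%O ->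
  rank p + rank q <= rank (p `&` q)%O + rank u.
Proof.
move=> pu qu.
have [f [ff [x [w [_ [y [_ [Ex Ew _ Ey _]]]]]]]] :=
  frame_map_exists pu (lexx _) (lexx q).
move: pu qu; rewrite -Ex -Ew -Ey (frame_meet _ _ ff) !(frame_rank _ ff).
move=> /(frame_le _ _ ff) xw /(frame_le _ _ ff) yw.
have := vsize_modular (le_vover_r xw yw).
by have := vsize_le (vover_le xw yw); lia.
Qed.

Lemma rank_modular_join p q u : (p <= u)%O -> (q <= u)%O ->
  rank (p `&` q)%O + rank u <= rank p + rank q -> is_join p q u.
Proof.
move=> pu qu.
have [f [ff [x [w [_ [y [_ [Ex Ew _ Ey _]]]]]]]] :=
  frame_map_exists pu (lexx _) (lexx q).
move: pu qu; rewrite -Ex -Ew -Ey (frame_meet _ _ ff) !(frame_rank _ ff).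
move=> /(frame_le _ _ ff) xw /(frame_le _ _ ff) yw le.
have szE := vsize_modular (le_vover_r xw yw).
have -> : w = vover x y by apply/esym/vsize_inj; [apply: vover_le | lia].
exact: (frame_join ff xw yw).
Qed.

(** * Distance in the covering graph and the elements of shortest paths *)

Lemma covers_rank p q : covers p q -> rank q = (rank p).+1.
Proof.
have [f [ff [x [y [<- <-]]]]] := frame2 p q.
move=> [xy nb]; rewrite !(frame_rank _ ff).
have lt := frame_lt ff xy; move/ltW/(frame_le _ _ ff): xy => le.
(* A vector one size above [x] and below [y] would lie strictly between them unless it already has
   the size of [y]. *)
have [z [xz zy sz]] := vle_step le lt.
have [E|ne] := eqVneq (vsize z) (vsize y); first by rewrite -E sz.
case: (nb (f z)); rewrite !lt_neqAle; split; apply/andP; split.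
- by apply/eqP => /(frame_inj ff) E; move: sz; rewrite E; lia.
- exact/(frame_le _ _ ff).
- by apply/eqP => /(frame_inj ff) E; move: ne; rewrite E eqxx.
- exact/(frame_le _ _ ff).
Qed.

Lemma rank_covers p q : (p <= q)%O -> rank q = (rank p).+1 -> covers p q.
Proof.
move=> pq E; split.
  rewrite lt_neqAle pq andbT; apply/eqP => pE; move: E; rewrite pE; lia.
by move=> z [/rank_lt pz /rank_lt zq]; lia.
Qed.

Lemma walk_up p q : (p <= q)%O -> exists w, walk w (rank q - rank p) p q.
Proof.
have [f [ff [x [y [<- <-]]]]] := frame2 p q => le.
have rle := rank_le le; move: le rle; rewrite !(frame_rank _ ff).
move=> /(frame_le _ _ ff) le rle.
have [|c [c0 ck cs]] := @vle_chain _ (vsize y - vsize x) _ _ le; first by lia.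
exists (f \o c); split; [by rewrite /= c0 | split; first by rewrite /= ck].
move=> i /cs [ci sz]; left; apply: rank_covers; first exact/(frame_le _ _ ff).
by rewrite !(frame_rank _ ff).
Qed.

Lemma walk_rev w k p q : walk w k p q -> walk (fun i => w (k - i)) k q p.
Proof.
move=> [w0 [wk ws]]; split; [by rewrite subn0 | split; first by rewrite subnn].
move=> i ik; have := ws (k - i.+1).
rewrite -subSn // subSS; case; [by lia | by right | by left].
Qed.

Lemma walk_cat w1 w2 k1 k2 p q u : walk w1 k1 p u -> walk w2 k2 u q ->
  exists w, walk w (k1 + k2) p q /\ w k1 = u.
Proof.
move=> [a0 [ak aS]] [b0 [bk bS]].
exists (fun i => if i <= k1 then w1 i else w2 (i - k1)).
split; last by rewrite leqnn.
split; [by rewrite leq0n | split].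
  case: leqP => [le|_]; last by rewrite addKn.
  have k20 : k2 = 0 by lia.
  by rewrite k20 addn0 ak -b0 -bk k20.
move=> i; case: (ltngtP i k1) => [lt|gt|->] ik.
- exact: aS.
- rewrite subSn; last exact: ltnW.
  by apply: bS; lia.
- by rewrite ak -b0 subSn // subnn; apply: bS; lia.
Qed.

(** The graph distance: descend from [p] to the meet, then climb to [q]. The truncated subtractions
    are exact because the meet has the smaller rank. *)
Definition rank_dist p q : nat :=
  (rank p - rank (p `&` q)%O) + (rank q - rank (p `&` q)%O).

Lemma walk_dist_exists p q : exists w, walk w (rank_dist p q) p q.
Proof.
have [w1 /walk_rev h1] := walk_up (leIl p q).
have [w2 h2] := walk_up (leIr q p).
by have [w [h _]] := walk_cat h1 h2; exists w.
Qed.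

(** Submodularity for the meets of [u] with [p] and with [q], both below [u]; their meet lies below
    that of [p] and [q]. *)
Lemma dist_triangle p q u : rank_dist p q <= rank_dist p u + rank_dist u q.
Proof.
have := rank_submodular (leIr u p) (leIl u q); rewrite /rank_dist.
have : rank ((p `&` u) `&` (u `&` q))%O <= rank (p `&` q)%O.
  by apply: rank_le; apply: leI2; [apply: leIl | apply: leIr].
have := rank_le (leIl p q); have := rank_le (leIr q p).
have := rank_le (leIl p u); have := rank_le (leIr u p).
have := rank_le (leIl u q); have := rank_le (leIr q u).
lia.
Qed.

Lemma adjacent_dist p q : adjacent p q -> rank_dist p q <= 1.
Proof.
rewrite /rank_dist; case=> /[dup] /covers_rank E [/ltW le _].
  by rewrite (meet_l le) E; lia.
by rewrite (meet_r le) E; lia.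
Qed.

Lemma walk_dist w k p q : walk w k p q -> rank_dist p q <= k.
Proof.
elim: k q => [|k IH] q [w0 [wk ws]].
  by rewrite -w0 -wk /rank_dist meetxx subnn.
apply: leq_trans (dist_triangle p q (w k)) _.
rewrite -addn1; apply: leq_add.
  by apply: IH; split=> //; split=> // i ik; apply: ws; lia.
by rewrite -wk; apply/adjacent_dist/ws.
Qed.

Lemma Iset_dist p q u : Iset p q u <-> rank_dist p u + rank_dist u q = rank_dist p q.
Proof.
split.
  move=> [w [k [[wk kmin] [i [ik <-]]]]].
  have [w' /kmin kd] := walk_dist_exists p q.
  have := dist_triangle p q (w i); have [w0 [wq ws]] := wk.
  have h1 : rank_dist p (w i) <= i.
    by apply: (@walk_dist w); split=> //; split=> // j ji; apply: ws; lia.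
  have h2 : rank_dist (w i) q <= k - i.
    apply: (@walk_dist (fun j => w (i + j))); rewrite /walk addn0 subnKC //.
    by do 2 split=> //; move=> j ji; rewrite addnS; apply: ws; lia.
  lia.
move=> E; have [w1 h1] := walk_dist_exists p u.
have [w2 h2] := walk_dist_exists u q.
have [w [h wu]] := walk_cat h1 h2.
exists w, (rank_dist p u + rank_dist u q); split.
  by split=> // w' k' /walk_dist; rewrite E.
by exists (rank_dist p u); split=> //; apply: leq_addr.
Qed.

(** * Rank conditions for I(p,q), and the joins as its elements *)

Lemma Iset_rank p q u : Iset p q u <->
  rank (u `&` p)%O + rank (u `&` q)%O = rank u + rank (p `&` q)%O.
Proof.
rewrite Iset_dist /rank_dist (meetC p u).
have := rank_le (leIl p q); have := rank_le (leIr q p).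
have := rank_le (leIr p u); have := rank_le (leIl u p).
have := rank_le (leIl u q); have := rank_le (leIr q u).
lia.
Qed.

Lemma Iset_join p q u : Iset p q u -> is_join (u `&` p)%O (u `&` q)%O u.
Proof.
move/Iset_rank => E; apply: rank_modular_join; rewrite ?leIl // E addnC leq_add2l.
by apply: rank_le; apply: leI2; apply: leIr.
Qed.

Lemma rank_rjoin p q : rank (rjoin p q) = rank (ljoin p q).
Proof.
have [f [ff [x [y [<- <-]]]]] := frame2 p q.
by rewrite (frame_ljoin _ _ ff) (frame_rjoin _ _ ff) !(frame_rank _ ff) vsize_voverC.
Qed.

Lemma rjoinE p q : rjoin p q = ljoin q p.
Proof.
have [f [ff [x [y [<- <-]]]]] := frame2 p q.
by rewrite (frame_ljoin _ _ ff) (frame_rjoin _ _ ff).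
Qed.

Lemma ljoin_ge p q : (p <= ljoin p q)%O.
Proof.
have [f [ff [x [y [<- <-]]]]] := frame2 p q.
by rewrite (frame_ljoin _ _ ff); apply/(frame_le _ _ ff)/le_vover.
Qed.

Lemma rank_ljoin_meet p q :
  rank (ljoin p q `&` q)%O + rank p = rank (ljoin p q) + rank (p `&` q)%O.
Proof.
have [f [ff [x [y [<- <-]]]]] := frame2 p q.
by rewrite (frame_ljoin _ _ ff) !(frame_meet _ _ ff) !(frame_rank _ ff) vsize_vover_part.
Qed.

Lemma Iset_sym p q u : Iset p q u -> Iset q p u.
Proof. by rewrite !Iset_rank (meetC q p) addnC. Qed.

Lemma Iset_ljoin p q : Iset p q (ljoin p q).
Proof.
by rewrite Iset_rank (meet_r (ljoin_ge p q)) addnC rank_ljoin_meet.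
Qed.

(** Both meets lie below [u], so in a frame containing them their vectors have a common bound and
    [vsize_compat] applies. *)
Lemma meet_rank_bound p q u :
  rank (u `&` p)%O + rank (u `&` q)%O <= rank (ljoin p q) + rank (p `&` q)%O.
Proof.
have [f [ff [s [x [_ [t [y [Es Ex _ Et Ey]]]]]]]] :=
  frame_map_exists (leIr p u) (lexx p) (leIr q u).
have [w [sw tw]] : exists w, S2n_le s w /\ S2n_le t w.
  by apply: (@frame_bound f _ _ u ff); rewrite ?Es ?Et leIl.
move: (leIr p u) (leIr q u); rewrite -Es -Et -Ex -Ey.
rewrite (frame_ljoin _ _ ff) (frame_meet _ _ ff) !(frame_rank _ ff).
move=> /(frame_le _ _ ff) sx /(frame_le _ _ ff) ty.
exact: vsize_compat sx ty sw tw.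
Qed.

(** The first rank equality puts [p] below [u], so the meet of [u] with [q] has a join with [p],
    namely [u]. It is therefore below the maximal such element, and equal to it by rank. *)
Lemma Iset_ljoin_unique p q u : Iset p q u ->
  rank (u `&` p)%O = rank p -> rank (u `&` q)%O = rank (ljoin p q `&` q)%O ->
  u = ljoin p q.
Proof.
move=> Iu rp rq; have := Iset_join Iu.
have -> : (u `&` p)%O = p by apply: rank_inj; rewrite ?leIr ?rp.
have up : (p <= u)%O by rewrite -(rank_inj (leIr p u)) ?leIl ?rp.
have [f [ff [x [y [Ex Ey]]]]] := frame2 p q.
have [_ _ _ best] := frame_left_part x y ff.
have lj := frame_left_join x y ff.
move: best lj; rewrite -(frame_meet _ _ ff) -(frame_ljoin _ _ ff) Ex Ey => best lj ju.
have E : (u `&` q)%O = (ljoin p q `&` q)%O.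
  apply: rank_inj; rewrite ?rq // best ?leIr //.
    by apply: leI2.
  by exists u.
by rewrite E in ju; apply: is_join_unique ju lj.
Qed.

End Frames.

(** * Angles of plane cones and their values *)

Section Cones.
Local Open Scope R_scope.

Lemma sin_ge0_inv t : - (PI / 2) <= t -> t <= PI / 2 -> 0 <= sin t -> 0 <= t.
Proof.
move=> t1 t2 s0; case: (Rle_lt_dec 0 t) => // t0.
by have := sin_lt_0_var t ltac:(have := PI_RGT_0; lra) t0; lra.
Qed.

Definition sector (a b x y : R) : Prop :=
  0 <= x /\ 0 <= y /\ y * cos a <= x * sin a /\ y * cos b >= x * sin b.

(** The two boundary rays of the smaller sector are tested in the larger one; the resulting
    inequalities say that the sines of [a' - a] and [b - b'] are nonnegative. *)
Lemma sector_sub a b a' b' : 0 <= b <= a -> a <= PI / 2 ->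
  0 <= b' <= a' -> a' <= PI / 2 ->
  (forall x y, sector a b x y -> sector a' b' x y) -> a <= a' /\ b' <= b.
Proof.
move=> ba a2 ba' a2' sub; have pi0 := PI_RGT_0.
have ca : 0 <= cos a by apply: cos_ge_0; lra.
have sa : 0 <= sin a by apply: sin_ge_0; lra.
have cb : 0 <= cos b by apply: cos_ge_0; lra.
have sb : 0 <= sin b by apply: sin_ge_0; lra.
have sab : 0 <= sin (a - b) by apply: sin_ge_0; lra.
rewrite sin_minus in sab.
have [|_ [_ [ha _]]] := sub (cos a) (sin a); first by rewrite /sector; lra.
have [|_ [_ [_ hb]]] := sub (cos b) (sin b); first by rewrite /sector; lra.
split.
  have := @sin_ge0_inv (a' - a); rewrite sin_minus; lra.
have := @sin_ge0_inv (b - b'); rewrite sin_minus; lra.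
Qed.

(** A sector determines its two angles, so the existential in [cone_value] admits one value only. *)
Lemma cone_value_sector (C : R * R -> Prop) a b c : 0 <= b <= a -> a <= PI / 2 ->
  (forall x y, C (x, y) <-> sector a b x y) ->
  cone_value C c <-> c = sin a / (sin a + cos a) - sin b / (sin b + cos b).
Proof.
move=> ba a2 CE; split; last by move=> ->; exists a, b; do 3 (split; first lra).
case=> [a' [b' [b0' [ba' [a2' [CE' ->]]]]]].
have [||||x y /CE /CE' //|] := @sector_sub a b a' b'; try lra.
have [||||x y /CE' /CE //|] := @sector_sub a' b' a b; try lra.
move=> h1 h2 h3 h4.
by have -> : a' = a by [lra]; have -> : b' = b by lra.
Qed.

Lemma cone_value_quadrant (C : R * R -> Prop) c :
  (forall x y, C (x, y) <-> 0 <= x /\ 0 <= y) -> cone_value C c <-> c = 1.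
Proof.
move=> CE; have pi0 := PI_RGT_0.
rewrite (@cone_value_sector C (PI / 2) 0); try lra; last first.
  by move=> x y; rewrite CE /sector sin_PI2 cos_PI2 sin_0 cos_0; lra.
rewrite sin_PI2 cos_PI2 sin_0 cos_0.
by have -> : 1 / (1 + 0) - 0 / (0 + 1) = 1 by field.
Qed.

Lemma cone_value_lower_half (C : R * R -> Prop) c :
  (forall x y, C (x, y) <-> [/\ 0 <= x, 0 <= y & y <= x]) ->
  cone_value C c <-> c = / 2.
Proof.
move=> CE; have pi0 := PI_RGT_0.
have cs : sin (PI / 4) = cos (PI / 4) by rewrite sin_PI4 cos_PI4.
have c0 : 0 < cos (PI / 4) by apply: cos_gt_0; lra.
(* The diagonal has angle [PI / 4], where sin / (sin + cos) is 1/2. *)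
rewrite (@cone_value_sector C (PI / 4) 0); try lra; last first.
  move=> x y; rewrite CE /sector cs sin_0 cos_0; split; first by case; nra.
  by case=> x0 [y0 [xy _]]; split=> //; nra.
rewrite cs sin_0 cos_0.
by have -> : cos (PI / 4) / (cos (PI / 4) + cos (PI / 4)) - 0 / (0 + 1) = / 2
  by field; lra.
Qed.

Lemma cone_value_upper_half (C : R * R -> Prop) c :
  (forall x y, C (x, y) <-> [/\ 0 <= x, 0 <= y & x <= y]) ->
  cone_value C c <-> c = / 2.
Proof.
move=> CE; have pi0 := PI_RGT_0.
have cs : sin (PI / 4) = cos (PI / 4) by rewrite sin_PI4 cos_PI4.
have c0 : 0 < cos (PI / 4) by apply: cos_gt_0; lra.
rewrite (@cone_value_sector C (PI / 2) (PI / 4)); try lra; last first.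
  move=> x y; rewrite CE /sector cs sin_PI2 cos_PI2; split; first by case; nra.
  by case=> x0 [y0 [_ xy]]; split=> //; nra.
rewrite cs sin_PI2 cos_PI2.
by have -> : 1 / (1 + 0) - cos (PI / 4) / (cos (PI / 4) + cos (PI / 4)) = / 2
  by field; lra.
Qed.

End Cones.

(** * Plane convex geometry of a rectangle with a corner cut off *)

Section Truncated_rectangle.
Local Open Scope R_scope.
(** [K] stands for Conv I(p,q). It is described by three linear bounds and by the edge on the line s
    + t = M, so the hull never has to be computed exactly. *)
Context (K : R * R -> Prop) (P Q M : R).
Hypothesis K_bounds :
  forall z, K z -> [/\ fst z <= P, snd z <= Q & fst z + snd z <= M].
Hypothesis K_segment : forall t, 0 <= t <= 1 ->
  K (t * P + (1 - t) * (M - Q), t * (M - P) + (1 - t) * Q).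

Lemma K_left : K (P, M - P).
Proof.
have := K_segment (t := 1); rewrite !Rmult_1_l.
by rewrite (_ : 1 - 1 = 0) ?Rmult_0_l ?Rplus_0_r; [apply; lra | lra].
Qed.

Lemma K_right : K (M - Q, Q).
Proof.
have := K_segment (t := 0); rewrite !Rmult_0_l !Rplus_0_l Rminus_0_r !Rmult_1_l.
by apply; lra.
Qed.

Lemma extreme_maximal z :
  extreme_point K z /\ cw_maximal K z <-> z = (P, M - P) \/ z = (M - Q, Q).
Proof.
have [/= _ LQ _] := K_bounds K_left.
split; last first.
  move=> E; split; split; try by case: E => ->; [apply: K_left | apply: K_right].
    case=> -[a1 a2] [[b1 b2]] [t [/K_bounds /= [pa qa ma]]].
    case=> /K_bounds /= [pb qb mb] [ne [t01 zE]]; apply: ne.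
    (* A proper convex combination of two numbers at most [w] equals [w] only if both do. It is
       applied first to the coordinate at its bound P or Q, then to the other one, bounded through
       M. *)
    have h u v w : u <= w -> v <= w -> w = t * u + (1 - t) * v -> u = w /\ v = w.
      by split; nra.
    case: E zE => -> [E1 E2].
      have [? ?] := h _ _ _ pa pb E1; subst a1 b1.
      by have [|||? ?] := h a2 b2 (M - P); try lra; subst a2 b2.
    have [? ?] := h _ _ _ qa qb E2; subst a2 b2.
    by have [|||? ?] := h a1 b1 (M - Q); try lra; subst a1 b1.
  move=> [x y] /K_bounds /= [px qy mxy].
  by case: E => -> /= h1 h2; congr pair; lra.
case: z => s t [[Kz ext] [_ max]]; have [/= sP tQ stM] := K_bounds Kz.
(* A point no higher than the left corner, or no further right than the right corner, is dominated
   by that corner. *)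
case: (Rle_lt_dec t (M - P)) => tl.
  by left; apply/esym/max; [apply: K_left | rewrite /=; lra | rewrite /=; lra].
case: (Rle_lt_dec s (M - Q)) => sl.
  by right; apply/esym/max; [apply: K_right | rewrite /=; lra | rewrite /=; lra].
have D : 0 < P + Q - M by lra.
(* The point of the edge with parameter [r] has first coordinate [s] and second coordinate [M - s],
   at least [t]. Maximality makes it equal to the given point, which then lies strictly inside the
   edge and is not extreme. *)
set r := (s - (M - Q)) / (P + Q - M).
have rE : r * (P + Q - M) = s - (M - Q) by rewrite /r; field; lra.
have r0 : 0 < r by apply: Rdiv_lt_0_compat; lra.
have r1 : r < 1 by nra.
have := max _ (K_segment (t := r) (conj (Rlt_le _ _ r0) (Rlt_le _ _ r1))).
rewrite /= => /(_ ltac:(nra) ltac:(nra)) E.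
case: ext; exists (P, M - P), (M - Q, Q), r.
do 2 (split; first by [apply: K_left | apply: K_right]).
split; first by case; lra.
by split.
Qed.

(** Comparing the two corners gives y (P + Q - M) <= x (P + Q - M), hence y <= x. Conversely, x s +
    y t = (x - y) s + y (s + t) is maximized termwise at the left corner. *)
Lemma left_cone w : 0 <= fst w -> 0 <= snd w -> M < P + Q ->
  (forall z, K z -> dot w z <= dot w (P, M - P)) <-> snd w <= fst w.
Proof.
case: w => x y /= x0 y0 D; split.
  by move/(_ _ K_right); rewrite /dot /=; nra.
move=> yx [s t] /K_bounds /= [sP tQ stM]; rewrite /dot /=.
have : 0 <= (x - y) * (P - s) by apply: Rmult_le_pos; lra.
have : 0 <= y * (M - (s + t)) by apply: Rmult_le_pos; lra.
lra.
Qed.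

Lemma right_cone w : 0 <= fst w -> 0 <= snd w -> M < P + Q ->
  (forall z, K z -> dot w z <= dot w (M - Q, Q)) <-> fst w <= snd w.
Proof.
case: w => x y /= x0 y0 D; split.
  by move/(_ _ K_left); rewrite /dot /=; nra.
move=> yx [s t] /K_bounds /= [sP tQ stM]; rewrite /dot /=.
have : 0 <= (y - x) * (Q - t) by apply: Rmult_le_pos; lra.
have : 0 <= x * (M - (s + t)) by apply: Rmult_le_pos; lra.
lra.
Qed.

End Truncated_rectangle.

(** * The hull Conv I(p,q) and the coefficients of the fractional join *)

Section Coefficients.
Context {disp : Order.disp_t} {T : meetSemilatticeType disp}.
Local Open Scope R_scope.

Lemma ConvI_le (p q : T) (w : R * R) m :
  (forall u, Iset p q u -> dot w (rvec p q u) <= m) ->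
  forall z, ConvI p q z -> dot w z <= m.
Proof.
move=> bd z [k [lam [us [pos [sum1 [z1 z2]]]]]].
rewrite /dot z1 z2 -[m]Rmult_1_l -sum1 {z1 z2 sum1}.
elim: k pos => [|k IH] pos /=; first lra.
have := IH (fun i ik => pos i (ltnW ik)).
have [l0 /bd le] := pos k (ltnSn k).
have := Rmult_le_compat_l _ _ _ l0 le; rewrite /dot /=; lra.
Qed.

Lemma ConvI_segment (p q u v : T) t : Iset p q u -> Iset p q v -> 0 <= t <= 1 ->
  ConvI p q (t * fst (rvec p q u) + (1 - t) * fst (rvec p q v),
             t * snd (rvec p q u) + (1 - t) * snd (rvec p q v)).
Proof.
move=> Iu Iv t01.
exists 2%nat, (fun i => if i is 0%nat then t else 1 - t),
  (fun i => if i is 0%nat then u else v).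
split; first by case=> [|i] _; split=> //; lra.
by rewrite /=; split; [lra | split; lra].
Qed.

Context {n : nat} {Frames : (T -> Prop) -> Prop}.
Hypothesis polar : is_polar_space n Frames.
Implicit Types p q u : T.

(** With [join_excess], these supply the parameters of the truncated rectangle: P is [excess p q], Q
    is [excess q p] and M is [join_excess p q]. *)
Definition excess p q := INR (rank p) - INR (rank (p `&` q)%O).
Definition join_excess p q := INR (rank (ljoin p q)) - INR (rank (p `&` q)%O).

Lemma rvec_ljoin p q : rvec p q (ljoin p q) = (excess p q, join_excess p q - excess p q).
Proof.
have := f_equal INR (rank_ljoin_meet polar p q).
rewrite !plus_INR /rvec /excess /join_excess (meet_r (ljoin_ge polar p q)) => E.
by congr pair; lra.
Qed.

Lemma rvec_rjoin p q : rvec p q (rjoin p q) = (join_excess p q - excess q p, excess q p).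
Proof.
have := f_equal INR (rank_ljoin_meet polar q p).
rewrite !plus_INR -(rjoinE polar) (rank_rjoin polar) /rvec /excess /join_excess (meetC q p).
have -> : (rjoin p q `&` q)%O = q.
  by apply: meet_r; rewrite (rjoinE polar) (ljoin_ge polar).
by move=> E; congr pair; lra.
Qed.

Lemma Iset_rjoin p q : Iset p q (rjoin p q).
Proof.
by rewrite (rjoinE polar); apply/(Iset_sym polar)/(Iset_ljoin polar).
Qed.

Lemma rvec_inj_ljoin p q u : Iset p q u ->
  rvec p q u = rvec p q (ljoin p q) -> u = ljoin p q.
Proof.
move=> Iu [E1 E2]; apply: (Iset_ljoin_unique polar Iu); apply: INR_eq; last lra.
by rewrite (meet_r (ljoin_ge polar p q)) in E1; lra.
Qed.

Lemma rvec_inj_rjoin p q u : Iset p q u ->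
  rvec p q u = rvec p q (rjoin p q) -> u = rjoin p q.
Proof.
rewrite (rjoinE polar) => /(Iset_sym polar) Iu [E1 E2].
apply: (rvec_inj_ljoin Iu); rewrite /rvec (meetC q p).
by congr pair; lra.
Qed.

Lemma ConvI_bounds p q z : ConvI p q z ->
  [/\ fst z <= excess p q, snd z <= excess q p & fst z + snd z <= join_excess p q].
Proof.
move=> cz.
have le := ConvI_le _ cz.
split.
- suff : dot (1, 0) z <= excess p q by rewrite /dot /=; lra.
  apply: le => u _; rewrite /dot /rvec /excess /=.
  by have := le_INR _ _ (ssrnat.leP (rank_le polar (leIr p u))); lra.
- suff : dot (0, 1) z <= excess q p by rewrite /dot /=; lra.
  apply: le => u _; rewrite /dot /rvec /excess (meetC q p) /=.
  by have := le_INR _ _ (ssrnat.leP (rank_le polar (leIr q u))); lra.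
- suff : dot (1, 1) z <= join_excess p q by rewrite /dot /=; lra.
  apply: le => u _; rewrite /dot /rvec /join_excess /=.
  have := le_INR _ _ (ssrnat.leP (meet_rank_bound polar p q u)); rewrite !plus_INR.
  lra.
Qed.

Lemma ConvI_join_segment p q t : 0 <= t <= 1 ->
  ConvI p q (t * excess p q + (1 - t) * (join_excess p q - excess q p),
             t * (join_excess p q - excess p q) + (1 - t) * excess q p).
Proof.
move=> t01.
have := ConvI_segment (Iset_ljoin polar p q) (Iset_rjoin p q) t01.
by rewrite rvec_ljoin rvec_rjoin.
Qed.

Lemma Eset_joins p q u : Eset p q u <-> u = ljoin p q \/ u = rjoin p q.
Proof.
have EM := extreme_maximal (@ConvI_bounds p q) (@ConvI_join_segment p q).
rewrite -rvec_ljoin -rvec_rjoin in EM.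
split.
  by case=> Iu /EM [/(rvec_inj_ljoin Iu)|/(rvec_inj_rjoin Iu)]; [left | right].
move=> Eu; split.
  by case: Eu => ->; [apply: (Iset_ljoin polar) | apply: Iset_rjoin].
by apply/EM; case: Eu => ->; [left | right].
Qed.

(** The left corner satisfies M - P <= Q, so the hypothesis gives M = P + Q. The two corners then
    coincide, and each is attained by a single element. *)
Lemma joins_eq p q : excess p q + excess q p <= join_excess p q -> ljoin p q = rjoin p q.
Proof.
move=> D; apply: rvec_inj_rjoin (Iset_ljoin polar p q) _.
rewrite rvec_ljoin rvec_rjoin.
have [/= _ + _] := ConvI_bounds (K_left (@ConvI_join_segment p q)).
by move=> D'; congr pair; lra.
Qed.

Lemma Ccone_joined p q x y : ljoin p q = rjoin p q ->
  Ccone p q (ljoin p q) (x, y) <-> 0 <= x /\ 0 <= y.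
Proof.
move=> /(f_equal (rvec p q)); rewrite /Ccone rvec_ljoin rvec_rjoin /= => -[E _].
(* When the joins agree their common vector is (P, Q), the upper right corner of the full rectangle,
   which maximizes every nonnegative functional. *)
split=> [[? [? _]] //|[x0 y0]]; split=> //; split=> // -[s t] /ConvI_bounds /= [sP tQ stM].
by rewrite /dot /=; nra.
Qed.

Lemma Ccone_ljoin p q x y : ljoin p q <> rjoin p q ->
  Ccone p q (ljoin p q) (x, y) <-> [/\ 0 <= x, 0 <= y & y <= x].
Proof.
move=> ne; have D : join_excess p q < excess p q + excess q p.
  by apply: Rnot_le_lt => /joins_eq.
have H := @left_cone _ _ _ _ (@ConvI_bounds p q) (@ConvI_join_segment p q) (x, y).
rewrite /Ccone rvec_ljoin /=.
by split=> [[x0 [y0 /H h]]|[x0 y0 h]]; [split=> //; apply: h | do 2 split=> //; apply/H].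
Qed.

Lemma Ccone_rjoin p q x y : ljoin p q <> rjoin p q ->
  Ccone p q (rjoin p q) (x, y) <-> [/\ 0 <= x, 0 <= y & x <= y].
Proof.
move=> ne; have D : join_excess p q < excess p q + excess q p.
  by apply: Rnot_le_lt => /joins_eq.
have H := @right_cone _ _ _ _ (@ConvI_bounds p q) (@ConvI_join_segment p q) (x, y).
rewrite /Ccone rvec_rjoin /=.
by split=> [[x0 [y0 /H h]]|[x0 y0 h]]; [split=> //; apply: h | do 2 split=> //; apply/H].
Qed.

(** Uniqueness of the cone value determines what [epsilon] returns. *)
Lemma fjoin_coef_Eset p q u v : Eset p q u ->
  (forall c, cone_value (Ccone p q u) c <-> c = v) -> fjoin_coef p q u = v.
Proof.
move=> Eu cv; rewrite /fjoin_coef; set S := (X in epsilon _ X).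
have [h _] : S (epsilon (inhabits 0) S).
  by apply: epsilon_spec; exists v; split=> // _; apply/cv.
exact/cv/h.
Qed.

Lemma fjoin_coef_notin p q u : ~ Eset p q u -> fjoin_coef p q u = 0.
Proof.
move=> Eu; rewrite /fjoin_coef; set S := (X in epsilon _ X).
have [_ h] : S (epsilon (inhabits 0) S) by apply: epsilon_spec; exists 0.
exact: h.
Qed.

End Coefficients.

Theorem theorem3p6 (disp : Order.disp_t) (T : meetSemilatticeType disp)
  (n : nat) (Frames : (T -> Prop) -> Prop) :
  is_polar_space n Frames ->
  forall p q u : T,
    fjoin_coef p q u =
      ((if u == ljoin p q then / 2 else 0) + (if u == rjoin p q then / 2 else 0))%R.
Proof.
move=> polar p q u.
have EJ := Eset_joins polar p q u.
(* Four cases: [u] is both joins, only the left one, only the right one, or neither. In the first,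
   the coefficient 1 of the whole quadrant is the sum of the two halves. *)
case: (eqVneq u (ljoin p q)) EJ => [->|nl];
  [case: (eqVneq (ljoin p q) (rjoin p q)) => [E|/eqP ne] |
   case: (eqVneq u (rjoin p q)) nl => [->|nr] nl] => EJ.
- rewrite (@fjoin_coef_Eset _ _ p q _ 1%R); first lra.
    by apply/EJ; left.
  by move=> c; apply: cone_value_quadrant => x y; apply: (Ccone_joined polar).
- rewrite (@fjoin_coef_Eset _ _ p q _ (/ 2)%R); first lra.
    by apply/EJ; left.
  by move=> c; apply: cone_value_lower_half => x y; apply: (Ccone_ljoin polar).
- rewrite (@fjoin_coef_Eset _ _ p q _ (/ 2)%R); first lra.
    by apply/EJ; right.
  move=> c; apply: cone_value_upper_half => x y; apply: (Ccone_rjoin polar) => E.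
  by rewrite E eqxx in nl.
- rewrite fjoin_coef_notin; first lra.
  by case/EJ => E; [rewrite E eqxx in nl | rewrite E eqxx in nr].
Qed.
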